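(* Let $n$ be a positive integer and let $G$ be a $2K_2$-free bipartite graph with $n$ vertices in each part. Then $\tilde h(G)\ge \lceil n/2\rceil$. This bound is tight, i.e., for every positive integer $n$ there is a $2K_2$-free bipartite graph $G$ with $n$ vertices in each part and $\tilde h(G)=\lceil n/2\rceil$.
   Context: All graphs are finite. A bipartite graph $G=((U,V),E)$ comes with a fixed ordered pair of parts (top part $U$, bottom part $V$) and $E\subseteq U\times V$. $\tilde\omega(G)$ is the largest integer $t$ such that there are $A\subseteq U$, $B\subseteq V$ with $|A|=|B|=t$ and $ab\in E$ for all $a\in A,b\in B$; $\tilde\alpha(G)$ is the largest integer $t$ such that there are $A\subseteq U$, $B\subseteq V$ with $|A|=|B|=t$ and $ab\notin E$ for all $a\in A$, $b\in B$; $\tilde h(G)=\max\{\tilde\alpha(G),\tilde\omega(G)\}$. A copy of $H=((X,Y),E_H)$ in $G$ is an induced copy respecting sides: injections $\phi:X\to U$ and $\psi:Y\to V$ with $xy\in E_H$ if and only if $\phi(x)\psi(y)\in E$, for all $x\in X$, $y\in Y$. $G$ is $H$-free if it contains no copy of $H$. $2K_2$ is the bipartite graph with two vertices in each part and exactly two edges, which are disjoint. *)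

(* Defs.v *)
From mathcomp Require Import all_boot.

Set Implicit Arguments.
Unset Strict Implicit.
Unset Printing Implicit Defensive.

Record bigraph := Bigraph {
  top : finType;
  bot : finType;
  edge : top -> bot -> bool
}.

Definition has_copy (H G : bigraph) : Prop :=
  exists (phi : top H -> top G) (psi : bot H -> bot G),
    [/\ injective phi, injective psi &
        forall (x : top H) (y : bot H), edge x y <-> edge (phi x) (psi y)].

Definition free (H G : bigraph) : Prop := ~ has_copy H G.

Definition twoK2 : bigraph :=
  @Bigraph 'I_2 'I_2 (fun i j => i == j).

Definition complete_pair (G : bigraph) (A : {set top G})
    (B : {set bot G}) : bool :=
  [forall a in A, forall b in B, edge a b].

Definition empty_pair (G : bigraph) (A : {set top G})
    (B : {set bot G}) : bool :=
  [forall a in A, forall b in B, ~~ edge a b].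

(* The range of each maximum contains (set0, set0), so the default value 0
   of \max on an empty range plays no role. *)
Definition omega_bip (G : bigraph) : nat :=
  \max_(p : {set top G} * {set bot G}
        | (#|p.1| == #|p.2|) && complete_pair p.1 p.2) #|p.1|.

Definition alpha_bip (G : bigraph) : nat :=
  \max_(p : {set top G} * {set bot G}
        | (#|p.1| == #|p.2|) && empty_pair p.1 p.2) #|p.1|.

Definition h_bip (G : bigraph) : nat := maxn (alpha_bip G) (omega_bip G).

(* Main.v *)
Require Import Defs.
From mathcomp Require Import all_boot zify.

(** In a [2K_2]-free bipartite graph the neighbourhoods of the top vertices
form a chain: a private neighbour of each of two top vertices would span a
[2K_2].  Hence, in any set of top vertices, a vertex of least degree has its
neighbours in common with the whole set, and a vertex of largest degree has its
non-neighbours in common with the whole set.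

Put [m = uphalf n] and split the top part into the vertices of degree at least
[m] and the others.  If there are [m] vertices of the first kind, they are
joined completely to the neighbourhood of the least of them.  Otherwise there
are at least [n - m + 1 >= m] of the second kind, each of degree at most
[m - 1], and all of them miss the [n - m + 1 >= m] non-neighbours of the
largest of them.

For tightness, join [m] of the top vertices to every bottom vertex and leave the
other [n - m <= m] isolated.  A nonempty complete pair then uses only the former
top vertices, and a nonempty empty pair only the latter. *)

Set Implicit Arguments.
Unset Strict Implicit.
Unset Printing Implicit Defensive.

Lemma exists_subset_card (T : finType) (A : {set T}) (t : nat) :
  t <= #|A| -> exists2 B : {set T}, B \subset A & #|B| = t.
Proof.
move=> /card_geqP[s [us <- sA]]; exists [set x in s].
  by apply/subsetP => x; rewrite inE => /sA.
by rewrite cardsE; apply/card_uniqP.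
Qed.

Section Bigraph.

Variable G : bigraph.
Implicit Types (A : {set top G}) (B : {set bot G}) (t : nat).

Lemma complete_pairP A B :
  reflect {in A & B, forall a b, edge a b} (complete_pair A B).
Proof.
apply: (iffP forall_inP) => [h a b aA bB | h a aA].
  exact: (forall_inP (h a aA)).
by apply/forall_inP => b bB; apply: h.
Qed.

Lemma empty_pairP A B :
  reflect {in A & B, forall a b, ~~ edge a b} (empty_pair A B).
Proof.
apply: (iffP forall_inP) => [h a b aA bB | h a aA].
  exact: (forall_inP (h a aA)).
by apply/forall_inP => b bB; apply: h.
Qed.

(** The two sides of the pair need not be balanced, as the larger one can be
trimmed. *)
Lemma leq_omega_bip A B t :
  t <= #|A| -> t <= #|B| -> complete_pair A B -> t <= omega_bip G.
Proof.
move=> /exists_subset_card[A' sA <-] /exists_subset_card[B' sB cB].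
move=> /complete_pairP AB; apply: (@leq_bigmax_cond _ _ _ (A', B')) => /=.
rewrite cB eqxx; apply/complete_pairP => a b aA bB.
by apply: AB; [apply: (subsetP sA) | apply: (subsetP sB)].
Qed.

Lemma leq_alpha_bip A B t :
  t <= #|A| -> t <= #|B| -> empty_pair A B -> t <= alpha_bip G.
Proof.
move=> /exists_subset_card[A' sA <-] /exists_subset_card[B' sB cB].
move=> /empty_pairP AB; apply: (@leq_bigmax_cond _ _ _ (A', B')) => /=.
rewrite cB eqxx; apply/empty_pairP => a b aA bB.
by apply: AB; [apply: (subsetP sA) | apply: (subsetP sB)].
Qed.

Definition nbhd (u : top G) : {set bot G} := [set b | edge u b].

(** Otherwise [u] and [v] would each have a private neighbour, and these four
vertices would be a copy of [2K_2]. *)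
Lemma twoK2_free_nbhd_chain (u v : top G) :
  free twoK2 G -> (nbhd u \subset nbhd v) || (nbhd v \subset nbhd u).
Proof.
move=> Gfree; apply: contra_notT Gfree; rewrite negb_or => /andP[].
move=> /subsetPn[b]; rewrite !inE => ub vb.
move=> /subsetPn[c]; rewrite !inE => vc uc.
have nuv : u != v by apply: contraNneq vb => <-.
have nbc : b != c by apply: contraNneq uc => <-.
exists (fun i : 'I_2 => if i == ord0 then u else v).
exists (fun j : 'I_2 => if j == ord0 then b else c).
split.
- move=> [[|[|//]] ?] [[|[|//]] ?] //= uv; apply/val_inj => //=.
    by rewrite uv eqxx in nuv.
  by rewrite uv eqxx in nuv.
- move=> [[|[|//]] ?] [[|[|//]] ?] //= bc; apply/val_inj => //=.
    by rewrite bc eqxx in nbc.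
  by rewrite bc eqxx in nbc.
- by move=> [[|[|//]] ?] [[|[|//]] ?] /=;
    rewrite ?ub ?vc ?(negbTE vb) ?(negbTE uc).
Qed.

Lemma twoK2_free_nbhd_sub (u v : top G) :
  free twoK2 G -> #|nbhd u| <= #|nbhd v| -> nbhd u \subset nbhd v.
Proof.
move=> /(twoK2_free_nbhd_chain u v)/orP[//|vu] uv.
by rewrite -(_ : nbhd v = nbhd u) //; apply/eqP; rewrite eqEcard vu.
Qed.

(** The top vertices are split according to whether their degree reaches [t].
The hypothesis [0 < s] is needed to have an extremal vertex in the chosen
class. *)
Lemma twoK2_free_homogeneous_pair (s t : nat) :
  free twoK2 G -> 0 < s -> s + s <= #|top G|.+1 -> t + t <= #|bot G|.+1 ->
  exists A B, [/\ s <= #|A|, t <= #|B| & complete_pair A B || empty_pair A B].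
Proof.
move=> Gfree s0 le_s le_t; pose D := [set u | t <= #|nbhd u|].
have [sD|Ds] := leqP s #|D|.
  have [u0 u0D] : exists u, u \in D by apply/card_gt0P; apply: leq_trans sD.
  case: (arg_minnP (fun u => #|nbhd u|) u0D) => u uD umin.
  have {}uD : u \in D by [].
  exists D, (nbhd u); split=> //; first by move: uD; rewrite /D inE.
  apply/orP; left; apply/complete_pairP => a b aD bu.
  have /subsetP/(_ b bu) := twoK2_free_nbhd_sub Gfree (umin a aD).
  by rewrite /nbhd inE.
have sC : s <= #|~: D| by have := cardsC D; lia.
have [u0 u0D] : exists u, u \in ~: D by apply/card_gt0P; apply: leq_trans sC.
case: (arg_maxnP (fun u => #|nbhd u|) u0D) => u uC umax.
have {}uC : u \in ~: D by [].
exists (~: D), (~: nbhd u); split=> //.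
  by move: uC (cardsC (nbhd u)); rewrite /D !inE; lia.
apply/orP; right; apply/empty_pairP => a b aD; rewrite inE; apply: contra => ab.
by apply: (subsetP (twoK2_free_nbhd_sub Gfree (umax a aD))); rewrite /nbhd inE.
Qed.

Lemma twoK2_free_leq_h_bip (n : nat) :
  0 < n -> #|top G| = n -> #|bot G| = n -> free twoK2 G ->
  uphalf n <= h_bip G.
Proof.
move=> n0 cT cB Gfree.
have [||||A [B [mA mB /orP[AB|AB]]]] :=
    @twoK2_free_homogeneous_pair (uphalf n) (uphalf n) => //; try lia.
  by rewrite leq_max (leq_omega_bip mA mB AB) orbT.
by rewrite leq_max (leq_alpha_bip mA mB AB).
Qed.

End Bigraph.

Definition dominating_top (n m : nat) : bigraph :=
  @Bigraph 'I_n 'I_n (fun i _ => i < m).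

(** The edges of [2K_2] at one top vertex would already force both edges there,
since adjacency ignores the bottom vertex. *)
Lemma dominating_top_twoK2_free (n m : nat) : free twoK2 (dominating_top n m).
Proof.
move=> [phi [psi [_ _ e]]].
have /e /= h : edge (ord0 : top twoK2) (ord0 : bot twoK2) by [].
by have /e : edge (phi ord0) (psi ord_max) by [].
Qed.

(** In a nonempty homogeneous pair all the top vertices lie on the same side of
the threshold [m]. *)
Lemma h_bip_dominating_top (n m : nat) :
  m <= n -> h_bip (dominating_top n m) <= maxn (n - m) m.
Proof.
move=> lemn; pose L := [set i : 'I_n | i < m].
have cL : #|L| = m.
  rewrite -sum1dep_card -(big_ord_widen n (fun=> 1) lemn).
  by rewrite sum1_card card_ord.
have cLC : #|~: L| = n - m by have := cardsC L; rewrite card_ord cL; lia.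
rewrite geq_max; apply/andP; split; apply/bigmax_leqP => -[A B] /=.
  move=> /andP[/eqP AB /empty_pairP eAB]; rewrite leq_max -cLC.
  have [B0|[b bB]] := set_0Vmem B; last first.
    rewrite subset_leq_card //; apply/subsetP => a aA.
    by rewrite !inE; apply: (eAB a b).
  by rewrite AB B0 cards0.
move=> /andP[/eqP AB /complete_pairP cAB]; rewrite leq_max -cL orbC.
have [B0|[b bB]] := set_0Vmem B; last first.
  rewrite subset_leq_card //; apply/subsetP => a aA.
  by rewrite !inE; apply: (cAB a b).
by rewrite AB B0 cards0.
Qed.

Theorem lemma6 :
  (forall (n : nat) (G : bigraph),
      0 < n -> #|top G| = n -> #|bot G| = n -> free twoK2 G ->
      uphalf n <= h_bip G) /\
  (forall n : nat, 0 < n ->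
      exists G : bigraph,
        [/\ #|top G| = n, #|bot G| = n, free twoK2 G & h_bip G = uphalf n]).
Proof.
split=> [n G|n n0]; first exact: twoK2_free_leq_h_bip.
have Gfree := @dominating_top_twoK2_free n (uphalf n).
exists (dominating_top n (uphalf n)); split=> //=; try exact: card_ord.
apply/eqP; rewrite eqn_leq twoK2_free_leq_h_bip ?card_ord // andbT.
by apply: leq_trans (h_bip_dominating_top _) _; lia.
Qed.
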